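(* Suppose $\lambda_n=n$ for every $n\in\mathbb N=\{0,1,2,\dots\}$ (i.e. $S=(\lambda_n)_{n\in\mathbb N}=\mathbb N$). Then for every integer $k\ge1$, $$(-1)^k\,T_{k+1}\!\left(-\frac{\lambda_n}{2}\right)\le 0\qquad\text{for every } n\in\mathbb N .$$
   Context: For a sequence $0=\lambda_0<\lambda_1<\lambda_2<\cdots$ of real numbers and $k\ge1$, let $Q_{k+1}(X)=\prod_{i=0}^{k}(X-\lambda_i)=\sum_{i=1}^{k+1}\frac1{i!}Q_{k+1}^{(i)}(0)X^i$, and define the real polynomials $$R_{k+1}(X)=\frac1{X^2}\big[Q_{k+1}(X)-Q_{k+1}^{(1)}(0)X\big]=\sum_{i=2}^{k+1}\frac1{i!}Q_{k+1}^{(i)}(0)X^{i-2},\qquad T_{k+1}(X)=R_{k+1}(X+\lambda_k)-R_{k+1}(\lambda_k).$$ *)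

(* Defs.v *)
From HB Require Import structures.
From mathcomp Require Import all_boot all_order all_algebra.
From mathcomp Require Import reals.

Set Implicit Arguments.
Unset Strict Implicit.
Unset Printing Implicit Defensive.

Import Order.TTheory GRing.Theory Num.Theory.
Local Open Scope ring_scope.

(* The argument m of Qpoly, Rpoly and Tpoly is the subscript k+1 of
   Q_{k+1}, R_{k+1} and T_{k+1}; so lambda_k is lambda m.-1. *)

Definition Qpoly (R : realType) (lambda : nat -> R) (m : nat) : {poly R} :=
  \prod_(i < m) ('X - (lambda i)%:P).

(* The Euclidean quotient by 'X^2 is exact when lambda 0 = 0 and 0 < m:
   see Rpoly_mulX2. *)
Definition Rpoly (R : realType) (lambda : nat -> R) (m : nat) : {poly R} :=
  let Q := Qpoly lambda m in (Q - Q^`().[0] *: 'X) %/ 'X^2.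

Definition Tpoly (R : realType) (lambda : nat -> R) (m : nat) : {poly R} :=
  let Rm := Rpoly lambda m in
  Rm \Po ('X + (lambda m.-1)%:P) - (Rm.[lambda m.-1])%:P.

Lemma Qpoly_coef0 (R : realType) (lambda : nat -> R) (k : nat) :
  lambda 0%N = 0 -> (Qpoly lambda k.+1)`_0 = 0.
Proof.
move=> l0; rewrite -horner_coef0 /Qpoly big_ord_recl /= hornerM l0.
by rewrite hornerXsubC subrr mul0r.
Qed.

Lemma Rpoly_mulX2 (R : realType) (lambda : nat -> R) (k : nat) :
  lambda 0%N = 0 ->
  Rpoly lambda k.+1 * 'X^2 =
  Qpoly lambda k.+1 - (Qpoly lambda k.+1)^`().[0] *: 'X.
Proof.
move=> l0; rewrite /Rpoly /=; set P := _ - _.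
suff -> : P = drop_poly 2 P * 'X^2 by rewrite mulpK // monic_neq0 ?monicXn.
rewrite -{1}(poly_take_drop 2 P) -[RHS]add0r; congr (_ + _).
apply/polyP => i; rewrite coef_take_poly coef0; case: ltnP => // i2.
rewrite /P coefB coefZ coefX horner_coef0 coef_deriv mulr1n.
case: i i2 => [|[|//]] _ /=; first by rewrite Qpoly_coef0 // mulr0 subrr.
by rewrite mulr1 subrr.
Qed.

Lemma Rpoly_sum (R : realType) (lambda : nat -> R) (k : nat) :
  lambda 0%N = 0 ->
  Rpoly lambda k.+1 =
  \sum_(2 <= i < k.+2)
    ((i`!)%:R^-1 * ((Qpoly lambda k.+1)^`(i)).[0]) *: 'X^(i - 2).
Proof.
move=> l0; set Q := Qpoly _ _.
have szQ : size Q = k.+2.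
  by rewrite /Q /Qpoly size_prod_XsubC -[index_enum _]enumT size_enum_ord.
apply/polyP => j.
have -> : (Rpoly lambda k.+1)`_j = Q`_(j.+2).
  have := congr1 (fun p : {poly R} => p`_(j.+2)) (Rpoly_mulX2 k l0).
  by rewrite /= coefMXn coefB coefZ coefX /= mulr0 subr0 subn2.
rewrite coef_sum.
under eq_big_nat => i _.
  rewrite coefZ coefXn horner_coef0 coef_derivn addn0 ffactnn.
  rewrite -[_`_i *+ _]mulr_natl mulKf ?pnatr_eq0 -?lt0n ?fact_gt0 //.
  over.
rewrite (big_addn 0 _ 2) /= big_mkord.
under eq_bigr => i _ do rewrite addnK addn2.
have [jk|kj] := ltnP j (k.+2 - 2).
  rewrite (bigD1 (Ordinal jk)) //= eqxx mulr1 big1 ?addr0 // => i.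
  by rewrite -val_eqE /= eq_sym => /negPf ->; rewrite mulr0.
rewrite nth_default ?szQ; last by rewrite subn2 /= in kj; rewrite !ltnS.
rewrite big1 // => i _; case: eqP => [ji|]; last by rewrite mulr0.
by have := ltn_ord i; rewrite -ji ltnNge kj.
Qed.

(* Main.v *)
Require Import Defs.
From mathcomp Require Import all_boot all_order all_algebra.
From mathcomp Require Import reals.
From mathcomp Require Import ring lra.

Import Order.TTheory GRing.Theory Num.Theory.
Local Open Scope ring_scope.

(** Write [P_k(x) = (1 - x)(2 - x)...(k - x)] and [g_k = (-1)^k R_{k+1}].
    As [Q_{k+1}(x) = (-1)^k x P_k(x)], the definition of [R_{k+1}] becomes
    [x g_k(x) = P_k(x) - k!], so that [g_k(k) = - (k-1)!].  The theorem says
    that [g_k(x) <= g_k(k)] at the points [x = k - n/2], and this inequality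
    holds at every real [x <= k].

    For [x <= 0] the recurrence [g_{k+1} = (k+1) g_k - P_k]
    ([Rpoly_recurrence]) gives [g_{k+1}(x) <= - P_k(x) <= - k!] by induction,
    with no division by [x]; the point [x = 0], where [x g_k(x)] carries no
    information, is thus not special.

    For [0 < x <= k], multiplying by [x] turns the inequality into
    [P_k(x) <= (k-1)! (k - x)].  As [P_k(x) = (k - x) P_{k-1}(x)], it
    follows from the bound [|P_{k-1}(x)| <= (k-1)!] on the interval [[0, k]]
    ([normr_prod_succ_sub_le]): the distances from [x] to the nodes
    [1, ..., k-1] multiply to at most [(k-1)!]. *)

Lemma natr_fact_prod {R : comNzRingType} (k : nat) :
  k`!%:R = \prod_(i < k) (i.+1%:R : R).
Proof.
by rewrite fact_prod big_add1 /= big_mkord natr_prod.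
Qed.

(** When [x] lies beyond the last node [k], the nodes [k, k-1, ..., 1] are
    within [1, 2, ..., k] of [x].  Otherwise [|k - x| <= k], and the nodes
    below [k] are dealt with by induction. *)
Lemma normr_prod_succ_sub_le {R : realFieldType} (k : nat) (x : R) :
  0 <= x -> x <= k.+1%:R -> `|\prod_(i < k) (i.+1%:R - x)| <= k`!%:R.
Proof.
elim: k => [|k IHk] x_ge0 x_le; first by rewrite big_ord0 normr1.
have [x_lek|/ltW k_lex] := leP x k.+1%:R.
  rewrite big_ord_recr normrM factS mulnC natrM /=.
  apply: ler_pM; rewrite ?IHk //; apply/ler_normlP; split; lra.
rewrite normr_prod natr_fact_prod [leRHS](reindex_inj rev_ord_inj) /=.
apply: ler_prod => i _; rewrite normr_ge0 /=.
have i_le : (i.+1 <= k.+1)%N := ltn_ord i.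
have i_leR : (i.+1%:R : R) <= k.+1%:R by rewrite ler_nat.
have -> : (k.+1 - i.+1).+1%:R = k.+2%:R - i.+1%:R :> R.
  by rewrite -subSn // natrB // ltnW.
apply/ler_normlP; split; lra.
Qed.

Lemma fact_le_prod_succ_sub {R : realFieldType} (k : nat) (x : R) :
  x <= 0 -> k`!%:R <= \prod_(i < k) (i.+1%:R - x).
Proof.
move=> x_le0; rewrite natr_fact_prod.
by apply: ler_prod => i _; rewrite ler0n; lra.
Qed.

Section DividedPolynomial.

Variables (R : realType) (lambda : nat -> R).
Hypothesis lambda0 : lambda 0%N = 0.

Let N (k : nat) : {poly R} := \prod_(i < k) ('X - (lambda i.+1)%:P).

Lemma Qpoly_mulX (k : nat) : Qpoly lambda k.+1 = 'X * N k.
Proof. by rewrite /Qpoly big_ord_recl lambda0 subr0. Qed.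

Lemma Rpoly_mulX (k : nat) : Rpoly lambda k.+1 * 'X = N k - (N k).[0]%:P.
Proof.
apply: (mulIf (negbT (polyX_eq0 R))); rewrite -mulrA -expr2 Rpoly_mulX2 //.
rewrite Qpoly_mulX derivM derivX !hornerE -mul_polyC; ring.
Qed.

(** Passing from [k] to [k+1] multiplies [N] by ['X - lambda_{k+1}].  Splitting
    this factor in [N k.+1 - (N k.+1).[0]] leaves
    ['X * N k - lambda_{k+1} (N k - (N k).[0])], where both terms are multiples
    of ['X]. *)
Lemma Rpoly_recurrence (k : nat) :
  Rpoly lambda k.+2 = N k - (lambda k.+1)%:P * Rpoly lambda k.+1.
Proof.
apply: (mulIf (negbT (polyX_eq0 R))); rewrite mulrBl -mulrA !Rpoly_mulX.
rewrite {1 2}/N big_ord_recr -/(N k) !hornerE !rmorphM rmorphN /=; ring.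
Qed.

Lemma horner_Rpoly1 (x : R) : (Rpoly lambda 1).[x] = 0.
Proof.
suff -> : Rpoly lambda 1 = 0 by rewrite horner0.
apply: (mulIf (negbT (polyX_eq0 R))).
by rewrite Rpoly_mulX /N big_ord0 hornerC subrr mul0r.
Qed.

Lemma sign_horner_nodes (k : nat) (x : R) :
  (-1) ^+ k * (N k).[x] = \prod_(i < k) (lambda i.+1 - x).
Proof.
have -> : (-1) ^+ k = \prod_(i < k) (-1 : R) by rewrite prodr_const card_ord.
rewrite horner_prod -big_split /=.
by apply: eq_bigr => i _; rewrite hornerXsubC mulN1r opprB.
Qed.

Lemma sign_horner_Rpoly_mulX (k : nat) (x : R) :
  (-1) ^+ k * (Rpoly lambda k.+1).[x] * x =
  \prod_(i < k) (lambda i.+1 - x) - \prod_(i < k) lambda i.+1.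
Proof.
(* The subtracted product is the product of the [lambda i.+1 - x] at [x = 0]. *)
rewrite -sign_horner_nodes -[X in _ - X](eq_bigr _ (fun i _ => subr0 _)).
rewrite -sign_horner_nodes -mulrBr -mulrA; congr (_ * _).
by have := congr1 (horner^~ x) (Rpoly_mulX k); rewrite !hornerE.
Qed.

Lemma sign_horner_Rpoly_recurrence (k : nat) (x : R) :
  (-1) ^+ k.+1 * (Rpoly lambda k.+2).[x] =
  lambda k.+1 * ((-1) ^+ k * (Rpoly lambda k.+1).[x])
  - \prod_(i < k) (lambda i.+1 - x).
Proof.
rewrite Rpoly_recurrence -sign_horner_nodes hornerD hornerN hornerM hornerC.
by rewrite exprS; ring.
Qed.

End DividedPolynomial.

Section IntegerNodes.

Variables (R : realType) (lambda : nat -> R).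
Hypothesis lambdaE : forall n, lambda n = n%:R.

Let lambda0 : lambda 0%N = 0. Proof. exact: lambdaE. Qed.

Let prod_lambda (k : nat) (x : R) :
  \prod_(i < k) (lambda i.+1 - x) = \prod_(i < k) (i.+1%:R - x).
Proof. by apply: eq_bigr => i _; rewrite lambdaE. Qed.

Let sign_Rpoly_mulX (k : nat) (x : R) :
  (-1) ^+ k * (Rpoly lambda k.+1).[x] * x =
  \prod_(i < k) (i.+1%:R - x) - k`!%:R.
Proof.
rewrite sign_horner_Rpoly_mulX // prod_lambda natr_fact_prod.
by congr (_ - _); apply: eq_bigr => i _; rewrite lambdaE.
Qed.

Lemma sign_Rpoly_last (k : nat) :
  (-1) ^+ k.+1 * (Rpoly lambda k.+2).[k.+1%:R] = - k`!%:R.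
Proof.
have k1_neq0 : k.+1%:R != 0 :> R by rewrite pnatr_eq0.
apply: (mulIf k1_neq0); rewrite sign_Rpoly_mulX big_ord_recr /= subrr mulr0.
by rewrite factS natrM sub0r mulNr mulrC.
Qed.

(** The recurrence expresses the value through terms of one sign, since the
    products over the nodes are positive to the left of all of them. *)
Lemma sign_Rpoly_le_nonpos (k : nat) (x : R) :
  x <= 0 -> (-1) ^+ k.+1 * (Rpoly lambda k.+2).[x] <= - k`!%:R.
Proof.
move=> x_le0.
have step j : (-1) ^+ j * (Rpoly lambda j.+1).[x] <= 0 ->
    (-1) ^+ j.+1 * (Rpoly lambda j.+2).[x] <= - j`!%:R.
  move=> g_le0; rewrite sign_horner_Rpoly_recurrence // prod_lambda lambdaE.
  have := fact_le_prod_succ_sub j x x_le0.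
  have := mulr_ge0_le0 (ler0n R j.+1) g_le0; lra.
apply: (step k); elim: k => [|k /step g_le].
  by rewrite horner_Rpoly1 // mulr0.
by apply: le_trans g_le _; rewrite oppr_le0.
Qed.

Lemma sign_Rpoly_le_pos (k : nat) (x : R) :
  0 < x -> x <= k.+1%:R ->
  (-1) ^+ k.+1 * (Rpoly lambda k.+2).[x] <= - k`!%:R.
Proof.
move=> x_gt0 x_le; rewrite -(ler_pM2r x_gt0) sign_Rpoly_mulX.
rewrite big_ord_recr /= factS natrM.
have P_le : \prod_(i < k) (i.+1%:R - x) <= k`!%:R.
  exact: le_trans (ler_norm _) (normr_prod_succ_sub_le k x (ltW x_gt0) x_le).
have x_sub : 0 <= k.+1%:R - x by rewrite subr_ge0.
have := ler_wpM2r x_sub P_le; lra.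
Qed.

End IntegerNodes.

Theorem theorem8 (R : realType) (lambda : nat -> R)
    (hlambda : forall n : nat, lambda n = n%:R) (k : nat) (hk : (1 <= k)%N)
    (n : nat) :
  (-1) ^+ k * (Tpoly lambda k.+1).[- (lambda n / 2%:R)] <= 0.
Proof.
case: k hk => // k _.
rewrite /Tpoly /= hornerD hornerN hornerC horner_comp hornerD hornerX hornerC.
rewrite !hlambda mulrBr sign_Rpoly_last // subr_le0.
set x := _ + _.
have x_le : x <= k.+1%:R by rewrite /x gerDr oppr_le0 divr_ge0 ?ler0n.
have [x_le0|x_gt0] := leP x 0; first exact: sign_Rpoly_le_nonpos.
exact: sign_Rpoly_le_pos.
Qed.
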